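(* Let $\mathsf{X}$ be a finite connected graph with $t\in\{1,2\}$ ramified vertices such that every admissible path has at least one shared edge (with another admissible path). Let $\mathsf{X}_n$ be the $n$-th layer of a $\mathbb{Z}_p$-tower over $\mathsf{X}$ (given by a voltage assignment $\alpha$) in which the ramified vertices are totally ramified and the other vertices unramified. Write $\det(M_\alpha)=p^{\mu}U(T)f(T)$ with $U$ a unit of $\mathbb{Z}_p[[T]]$ and $f$ a distinguished polynomial, and let $\lambda=\deg f$. Then there is a constant $\nu$ such that $\operatorname{ord}_p(F_t(\mathsf{X}_n))=\mu p^n+\lambda n+\nu$ for all $n\gg0$.
   Context: Admissible path: a path between ramified vertices (possibly equal) all of whose intermediate vertices are unramified. $F_t(\mathsf{Y})$ is the number of spanning forests of $\mathsf{Y}$ with $t$ trees each containing exactly one ramified vertex (the ramified vertices of $\mathsf{X}_n$ are the unique preimages of those of $\mathsf{X}$). Tower: $\Gamma\cong\mathbb{Z}_p$ with topological generator $\gamma$, $\Lambda=\mathbb{Z}_p[[\Gamma]]\cong\mathbb{Z}_p[[T]]$ via $\gamma\mapsto1+T$, $\Gamma_n=\Gamma/\Gamma^{p^n}$; voltage assignment $\alpha$ from directed edges to $\Gamma$ with $\alpha(\bar e)=\alpha(e)^{-1}$; $I_v=\Gamma$ for ramified $v$, $I_v=1$ otherwise; $\mathsf{X}_n$ has vertices $\bigsqcup_v\{v\}\times\Gamma_n/\pi_n(I_v)$, directed edges $\mathbf{E}(\mathsf{X})\times\Gamma_n$, $(e,g)$ joining $(o(e),g\pi_n(I_{o(e)}))$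 to $(t(e),g\pi_n(\alpha(e))\pi_n(I_{t(e)}))$; all $\mathsf{X}_n$ connected. Order the vertices $v_1,\dots,v_r$ unramified and $v_{r+1},\dots,v_{r+t}$ ramified. $D$ is the diagonal matrix with entry $\deg(v_i)$ for unramified $v_i$ and $1$ for ramified $v_i$; $A_\alpha=(a_{ij})$ with $a_{ij}=\sum_{e:\ (o(e),t(e))=(v_j,v_i)}\alpha(e)\in\Lambda$ for $j\le r$ and $a_{ij}=0$ for $j>r$; $M_\alpha=D-A_\alpha$. *)

(* Defs.v *)
From HB Require Import structures.
From mathcomp Require Import all_boot all_order all_algebra.
From Stdlib Require Import ClassicalEpsilon.
Set Implicit Arguments. Unset Strict Implicit. Unset Printing Implicit Defensive.
Import GRing.Theory.
Local Open Scope ring_scope.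

Definition asb (P : Prop) : bool :=
  if excluded_middle_informative P then true else false.

(* p-adic integers Z_p, as coherent sequences of residues:                  *)
(*   zres a k = (a mod p^k), with zres a k = zres a (k+1) mod p^k.          *)
Record zp (p : nat) := ZP {
  zres : nat -> nat ;
  zres_coh : forall k, zres k = (zres k.+1 %% p ^ k)%N }.

Definition zp_is0 p (a : zp p) : Prop := forall k, zres a k = 0%N.
Definition zp_is1 p (a : zp p) : Prop := forall k, zres a k = (1 %% p ^ k)%N.
Definition zp_opp_rel p (a b : zp p) : Prop :=
  forall k, ((zres a k + zres b k) %% p ^ k)%N = 0%N.

(* Lambda = Z_p[[T]].  An element is its coefficient sequence nat -> Z_p.  *)
(* Lambda is the inverse limit of the rings (Z/p^(k+1))[T]/(T^m); we work   *)
(* with these truncations, represented by polynomials of size <= m over    *)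
(* 'Z_(p^(k+1)).                                                            *)
Definition trp (R : nzRingType) (m : nat) (P : {poly R}) : {poly R} :=
  \poly_(j < m) P`_j.

Definition ps (p : nat) := nat -> zp p.

Definition trunc p (F : ps p) (k m : nat) : {poly 'Z_(p ^ k.+1)} :=
  \poly_(j < m) ((zres (F j) k.+1)%:R : 'Z_(p ^ k.+1)).

(* image of the group element gamma^a = (1+T)^a, a in Z_p, in               *)
(* (Z/p^(k+1))[T]/(T^m).  Since (1+T)^(p^(k+1+m)) = 1 in that ring, this is  *)
(* (1+T)^(a mod p^(k+1+m)).                                                 *)
Definition gpow p (a : zp p) (k m : nat) : {poly 'Z_(p ^ k.+1)} :=
  trp m ((1 + 'X) ^+ zres a (k.+1 + m)).

Definition ps_unit p (U : ps p) : Prop :=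
  exists W : ps p, forall k m,
    trp m.+1 (trunc U k m.+1 * trunc W k m.+1) = 1.

Definition distinguished p (f : ps p) (lam : nat) : Prop :=
  [/\ zp_is1 (f lam),
      (forall j, (lam < j)%N -> zp_is0 (f j)) &
      (forall j, (j < lam)%N -> zres (f j) 1 = 0%N)].

(* Finite (multi)graphs in Serre's formalism: a finite set of vertices V, a *)
(* finite set of directed edges E, origin/terminus maps, and an inversion   *)
(* e |-> ebar which is a fixed-point-free involution with o(ebar) = t(e).   *)
Definition is_graph (V E : finType) (src dst : E -> V) (bar : E -> E) : Prop :=
  [/\ forall e, bar (bar e) = e, forall e, bar e != e & forall e, src (bar e) = dst e].

Definition gadj (V E : finType) (src dst : E -> V) (S : {set E}) : rel V :=
  fun x y => [exists e in S, (src e == x) && (dst e == y)].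

Definition gconnected (V E : finType) (src dst : E -> V) : Prop :=
  forall u v, connect (gadj src dst setT) u v.

Definition is_cycle (V E : finType) (src dst : E -> V) (bar : E -> E)
    (S : {set E}) (c : seq E) : bool :=
  [&& (0 < size c)%N, all (fun e => e \in S) c,
      path.cycle (fun e f => dst e == src f) c,
      uniq (map src c), uniq c &
      all (fun x => all (fun y => x != bar y) c) c].

(* S (a set of directed edges closed under bar, i.e. a set of undirected    *)
(* edges) is a spanning forest with t trees, each tree containing exactly   *)
(* one vertex of Rm (the ramified vertices).                               *)
Definition ramified_spanning_forest (V E : finType) (src dst : E -> V)
    (bar : E -> E) (Rm : {set V}) (t : nat) (S : {set E}) : Prop :=
  [/\ forall e, e \in S -> bar e \in S,
      forall c, ~~ is_cycle src dst bar S c,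
      #|[set [set w | connect (gadj src dst S) v w] | v : V]| = t &
      forall v, #|[set w in Rm | connect (gadj src dst S) v w]| = 1%N].

Definition Fcount (V E : finType) (src dst : E -> V) (bar : E -> E)
    (Rm : {set V}) (t : nat) : nat :=
  #|[set S : {set E} | asb (ramified_spanning_forest src dst bar Rm t S)]|.

Definition admissible (V E : finType) (src dst : E -> V) (bar : E -> E)
    (Rm : {set V}) (c : seq E) : bool :=
  match c with
  | [::] => false
  | e0 :: c' =>
      [&& path (fun e f => dst e == src f) e0 c',
          src e0 \in Rm, dst (last e0 c') \in Rm,
          all (fun v => v \notin Rm) (map dst (belast e0 c')),
          uniq (map dst (belast e0 c')), uniq c &
          all (fun x => all (fun y => x != bar y) c) c]
  end.

(* Every admissible path shares an (undirected) edge with another           *)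
(* admissible path (paths are considered up to reversal).                   *)
Definition every_admissible_path_shares_edge (V E : finType) (src dst : E -> V)
    (bar : E -> E) (Rm : {set V}) : Prop :=
  forall c, admissible src dst bar Rm c ->
    exists c', [/\ admissible src dst bar Rm c', c' <> c,
                   c' <> rev (map bar c) &
                   exists2 e, e \in c & (e \in c') || (bar e \in c')].

(* Voltage assignment alpha : E -> Gamma = Z_p (written additively via      *)
(* gamma^a <-> a), with alpha(ebar) = alpha(e)^(-1).                       *)
Definition voltage p (E : finType) (bar : E -> E) (alpha : E -> zp p) : Prop :=
  forall e, zp_opp_rel (alpha (bar e)) (alpha e).

(* The n-th layer X_n (Gamma_n = Z/p^n represented by 'I_(p^n)).  Vertices: *)
(* (v, g) for v unramified, g in Gamma_n, and a single vertex v for v       *)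
(* ramified (I_v = Gamma).  Directed edges: E x Gamma_n, (e,g) joining      *)
(* (o e, g) to (t e, g + alpha e).                                          *)
Lemma addI_proof (N : nat) (g : 'I_N) (a : nat) : ((g + a) %% N < N)%N.
Proof. by rewrite ltn_pmod // (leq_ltn_trans _ (ltn_ord g)). Qed.
Definition addI (N : nat) (g : 'I_N) (a : nat) : 'I_N := Ordinal (addI_proof g a).

Definition lvP (V : finType) (Rm : {set V}) (N : nat) (x : ((V * 'I_N) + V)%type)
  : bool :=
  match x with inl vg => vg.1 \notin Rm | inr v => v \in Rm end.

Definition LV (V : finType) (Rm : {set V}) (N : nat) :=
  {x : ((V * 'I_N) + V)%type | @lvP V Rm N x}.

Definition lvert (V : finType) (Rm : {set V}) (N : nat) (v : V) (g : 'I_N)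
  : LV Rm N :=
  match (v \in Rm) as b return (v \in Rm) = b -> LV Rm N with
  | true => fun h => exist _ (inr v) h
  | false => fun h => exist _ (inl (v, g)) (negbT h)
  end (erefl _).

Definition LE (E : finType) (N : nat) := (E * 'I_N)%type.

Section Layer.
Variables (p : nat) (V E : finType) (src dst : E -> V) (bar : E -> E)
          (Rm : {set V}) (alpha : E -> zp p) (n : nat).
Definition layer_src (x : LE E (p ^ n)) : LV Rm (p ^ n) := lvert Rm (src x.1) x.2.
Definition layer_dst (x : LE E (p ^ n)) : LV Rm (p ^ n) :=
  lvert Rm (dst x.1) (addI x.2 (zres (alpha x.1) n)).
Definition layer_bar (x : LE E (p ^ n)) : LE E (p ^ n) :=
  (bar x.1, addI x.2 (zres (alpha x.1) n)).
Definition layer_ram : {set LV Rm (p ^ n)} :=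
  [set x | if val x is inr _ then true else false].
Definition layer_F (t : nat) : nat :=
  Fcount layer_src layer_dst layer_bar layer_ram t.
End Layer.

(* The matrix M_alpha = D - A_alpha, with vertices ordered by enum V (the   *)
(* determinant does not depend on the ordering), reduced to                 *)
(* (Z/p^(k+1))[T]/(T^m).                                                    *)
Definition vdeg (V E : finType) (src : E -> V) (v : V) : nat :=
  #|[set e | src e == v]|.

Definition Mtr p (V E : finType) (src dst : E -> V) (Rm : {set V})
    (alpha : E -> zp p) (k m : nat) : 'M[{poly 'Z_(p ^ k.+1)}]_#|V| :=
  \matrix_(i, j)
    ((if i == j then
        (if enum_val i \in Rm then 1 else (vdeg src (enum_val i))%:R) else 0)
     - (if enum_val j \in Rm then 0 else
          \sum_(e | (src e == enum_val j) && (dst e == enum_val i))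
             gpow (alpha e) k m)).

Definition det_weierstrass p (V E : finType) (src dst : E -> V) (Rm : {set V})
    (alpha : E -> zp p) (mu : nat) (U f : ps p) : Prop :=
  forall k m,
    trp m (\det (Mtr src dst Rm alpha k m))
    = trp m ((p ^ mu)%:R * (trunc U k m * trunc f k m)).

(* Main.v *)
Require Import Defs.
From mathcomp Require Import all_boot all_order all_algebra.
From mathcomp Require Import all_fingroup all_field ring zify.
Set Implicit Arguments. Unset Strict Implicit. Unset Printing Implicit Defensive.
Import Order.TTheory GRing.Theory Num.Theory.
Local Open Scope ring_scope.

(** Orienting every tree towards its root identifies the forests counted by
    [F_t(X_n)] with arborescences, i.e. with choices of one outgoing edge at each
    unramified vertex such that every vertex reaches a ramified one.  These do not
    change when the ramified vertices of [X_n] are replaced by [p^n] separate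
    roots, and by the matrix-tree theorem they are counted by the determinant of
    the Laplacian of [V x Z/p^n].  The Fourier transform over [Z/p^n] factors that
    determinant as [prod_z D_n(z)], [z] ranging over the roots of
    [(1+T)^(p^n) - 1], where [D_n] is [det M_alpha] with exponents reduced mod
    [p^n].  Passing from [n] to [n+1] multiplies the count by the norm of
    [D_(n+1)] over the roots of the Eisenstein polynomial
    [P = ((1+T)^(p^(n+1)) - 1) / ((1+T)^(p^n) - 1)] of degree [phi = p^(n+1) - p^n].
    At these roots [det M_alpha] may be replaced by [p^mu U f] up to multiples of
    [p^(mu+2)] and [T^((mu+2)phi)], so once [phi > lambda] the norm has valuation
    [mu phi + lambda].  All norms are integer determinants of polynomials in a
    companion matrix, so no p-adic field is needed. *)

(** * Rooted forests and arborescences *)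

Lemma asbP (P : Prop) : reflect P (asb P).
Proof. by rewrite /asb; case: ClassicalEpsilon.excluded_middle_informative => h; constructor. Qed.

Section Arborescence.
Variables (V E : finType) (src dst : E -> V) (Rm : {set V}).
Implicit Types (T S : {set E}) (h : V -> nat).

Definition selects_out_edges T : bool :=
  [forall e in T, src e \notin Rm] &&
  [forall v in ~: Rm, #|[set e in T | src e == v]| == 1%N].

(** Acyclicity is not imposed separately: reachability of a root from every vertex, with one
    outgoing edge per non-root, already excludes directed cycles. *)
Definition arborescence T : bool :=
  selects_out_edges T &&
  [forall v, exists w in Rm, connect (gadj src dst T) v w].

Lemma gadjP S x y :
  reflect (exists e, [/\ e \in S, src e = x & dst e = y]) (gadj src dst S x y).
Proof.
apply: (iffP exists_inP) => [[e eS /andP[/eqP <- /eqP <-]]|[e [eS <- <-]]].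
  by exists e.
by exists e; rewrite ?eqxx.
Qed.

Lemma selectsP T : selects_out_edges T ->
  [/\ forall e, e \in T -> src e \notin Rm,
      forall v, v \notin Rm -> exists2 e, e \in T & src e = v &
      forall e e', e \in T -> e' \in T -> src e = src e' -> e = e'].
Proof.
case/andP => /forall_inP h1 /forall_inP h2; split => // [v vR|e e' eT e'T s].
  have /cards1P[e eE] : #|[set e in T | src e == v]| == 1%N by apply: h2; rewrite inE.
  have : e \in [set e in T | src e == v] by rewrite eE set11.
  by rewrite inE => /andP[eT /eqP ev]; exists e.
have /cards1P[x xE] : #|[set e0 in T | src e0 == src e]| == 1%N.
  by apply: h2; rewrite inE h1.
have : e \in [set e0 in T | src e0 == src e] by rewrite inE eT eqxx.
have : e' \in [set e0 in T | src e0 == src e] by rewrite inE e'T s eqxx.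
by rewrite xE !inE => /eqP-> /eqP->.
Qed.

Lemma selectsI T :
  (forall e, e \in T -> src e \notin Rm) ->
  (forall v, v \notin Rm -> exists2 e, e \in T & src e = v) ->
  (forall e e', e \in T -> e' \in T -> src e = src e' -> e = e') ->
  selects_out_edges T.
Proof.
move=> h1 h2 h3; apply/andP; split; apply/forall_inP => //= v; rewrite inE => vR.
have [e eT ev] := h2 _ vR; apply/cards1P; exists e; apply/setP => e'.
rewrite !inE; apply/andP/eqP => [[e'T /eqP e'v]|->]; last by rewrite ev.
by apply: h3 => //; rewrite e'v ev.
Qed.

Lemma connect_exit S (x y : V) : connect (gadj src dst S) x y -> x != y ->
  exists2 e, e \in S & src e = x /\ connect (gadj src dst S) (dst e) y.
Proof.
case/connectP => -[|z q] /= => [_ ->|/andP[/gadjP[e [eS ex ez]] pq] -> _].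
  by rewrite eqxx.
by exists e; rewrite // ex ez; split=> //; apply/connectP; exists q.
Qed.

Lemma height_exists S : (forall v, exists2 w, w \in Rm & connect (gadj src dst S) v w) ->
  exists h, forall v, v \notin Rm ->
    exists e, [/\ e \in S, src e = v & (h (dst e) < h v)%N].
Proof.
move=> cS.
(* [h v] is the distance from [v] to [Rm] in [S]. *)
pose P v k := [exists q : k.-tuple V, path (gadj src dst S) v q && (last v q \in Rm)].
have exP v : exists k, P v k.
  have [w wR /connectP[q pq lw]] := cS v.
  by exists (size q); apply/existsP; exists (in_tuple q); rewrite /= pq -lw.
pose h v := ex_minn (exP v); exists h => v vR.
have /existsP[q /andP[pq lq]] : P v (h v) by rewrite /h; case: ex_minnP.
case: q pq lq => -[|z q] /= szq; first by move=> _; rewrite (negPf vR).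
case/andP => /gadjP[e [eS ev ez]] pq lq; exists e; split=> //.
rewrite -(eqP szq) ltnS ez /h; case: ex_minnP => m _; apply.
by apply/existsP; exists (in_tuple q); rewrite /= pq.
Qed.

(** The unique edge leaving a vertex must be the one along which the distance to the roots drops.
    Conversely, descent along [T] cannot go on forever, and it can stop only at a root. *)
Lemma arborescenceP T : reflect
  (selects_out_edges T /\ exists h, forall e, e \in T -> (h (dst e) < h (src e))%N)
  (arborescence T).
Proof.
apply: (iffP andP) => [[sT /forallP cT]|[sT [h hT]]]; split=> //.
  have [h1 h2 h3] := selectsP sT.
  have [v|h hh] := @height_exists T; first exact/exists_inP/cT.
  exists h => e eT; have [e' [e'T s lt]] := hh _ (h1 _ eT).
  by rewrite -(h3 _ _ e'T eT s) s.
have [_ h2 _] := selectsP sT.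
apply/forallP => v; have [k] := ubnP (h v); elim: k v => // k IH v hv.
apply/exists_inP; have [vR|vR] := boolP (v \in Rm); first by exists v.
have [e eT ev] := h2 _ vR; have := hT _ eT; rewrite ev => lt.
have /exists_inP[w wR cw] := IH _ (leq_trans lt hv).
exists w => //; apply: connect_trans cw; apply/connect1/gadjP; by exists e.
Qed.

(** At each non-root one edge of [S] that lowers the height is kept; the height then certifies the
    result. *)
Lemma sub_arborescence S :
  (forall v, exists2 w, w \in Rm & connect (gadj src dst S) v w) ->
  exists2 T, arborescence T & T \subset S.
Proof.
case/height_exists => h hh.
pose c v := [pick e | [&& e \in S, src e == v & (h (dst e) < h v)%N]].
have cP v : v \notin Rm -> exists e, [/\ c v = Some e, e \in S, src e = v & (h (dst e) < h v)%N].
  move=> /hh[e [eS ev lt]]; rewrite /c; case: pickP => [e' /and3P[? /eqP ? ?]|/(_ e)].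
    by exists e'.
  by rewrite eS ev eqxx lt.
exists [set e | (src e \notin Rm) && (c (src e) == Some e)]; last first.
  apply/subsetP => e; rewrite inE => /andP[/cP[e' [-> e'S _ _]] /eqP e'e].
  by rewrite -(Some_inj e'e).
apply/arborescenceP; split; last first.
  exists h => e; rewrite inE => /andP[/cP[e' [-> _ s lt]] /eqP e'e].
  by rewrite -(Some_inj e'e) s -(Some_inj e'e) in lt *.
apply: selectsI => [e|v vR|e e']; first by rewrite inE => /andP[].
  by have [e [ce _ ev _]] := cP _ vR; exists e; rewrite // inE ev vR ce eqxx.
rewrite !inE => /andP[_ /eqP h1] /andP[_ /eqP h2] s.
by apply: Some_inj; rewrite -h1 -h2 s.
Qed.

End Arborescence.

(** * Undirected forests as arborescences with forgotten orientation *)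

Section Forests.
Variables (V E : finType) (src dst : E -> V) (bar : E -> E) (Rm : {set V}).
Hypothesis graphG : is_graph src dst bar.

Let barK e : bar (bar e) = e. Proof. by case: graphG. Qed.
Let bar_neq e : bar e != e. Proof. by case: graphG. Qed.
Let src_bar e : src (bar e) = dst e. Proof. by case: graphG. Qed.
Let dst_bar e : dst (bar e) = src e. Proof. by rewrite -src_bar barK. Qed.

Local Notation adj := (gadj src dst).
Local Notation arbo := (arborescence src dst Rm).

Definition undirected (T : {set E}) : {set E} := [set e | (e \in T) || (bar e \in T)].

Lemma undirected_bar T e : (bar e \in undirected T) = (e \in undirected T).
Proof. by rewrite !inE barK orbC. Qed.

Lemma sub_undirected (T : {set E}) : T \subset undirected T.
Proof. by apply/subsetP => e; rewrite inE => ->. Qed.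

Lemma sub_adj (S S' : {set E}) : S \subset S' -> subrel (connect (adj S)) (connect (adj S')).
Proof.
move/subsetP => sub; apply: connect_sub => x y /gadjP[e [eS <- <-]].
by apply/connect1/gadjP; exists e; split=> //; apply: sub.
Qed.

Lemma connect_adj_sym (S : {set E}) : (forall e, e \in S -> bar e \in S) ->
  connect_sym (adj S).
Proof.
move=> barS; apply: sym_connect_sym => x y.
by apply/gadjP/gadjP => -[e [/barS eS <- <-]]; exists (bar e); rewrite src_bar dst_bar.
Qed.

Lemma undirected_sym T : connect_sym (adj (undirected T)).
Proof. by apply: connect_adj_sym => e; rewrite undirected_bar. Qed.

(* At a highest vertex of a cycle both cycle edges would be the unique edge of [T] leaving it. *)
Lemma arborescence_acyclic T c : arbo T -> ~~ is_cycle src dst bar (undirected T) c.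
Proof.
case/arborescenceP => /selectsP[_ _ uT] [h hT]; apply/negP.
case/and5P => sz /allP cS cyc _ /andP[_ /allP nbar].
case: c sz cS cyc nbar => // e0 c0 _; set c := e0 :: c0 => cS cyc nbar.
have e0c : e0 \in c by rewrite inE eqxx.
have [e ec emax] := @arg_maxnP E e0 (mem c) (h \o src) e0c.
have eT : e \in T.
  have := cS _ ec; rewrite inE => /orP[//|/hT].
  rewrite src_bar dst_bar (eqP (next_cycle cyc ec)) ltnNge.
  have nc : next c e \in c by rewrite mem_next.
  by have /= -> := emax _ nc.
have := prev_cycle cyc ec; set e' := prev c e => /eqP e'e.
have e'c : e' \in c by rewrite mem_prev.
have := cS _ e'c; rewrite inE => /orP[/hT|be'T].
  by rewrite e'e ltnNge; have /= -> := emax _ e'c.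
have := nbar _ ec => /allP/(_ _ e'c) /eqP; apply.
by apply: uT => //; rewrite src_bar.
Qed.

(** A directed path from [src e] to a root has to begin with [e], the only edge leaving [src e]; so
    both ends of an edge of [T] reach the same roots. *)
Lemma arborescence_roots T x y w : arbo T -> connect (adj (undirected T)) x y ->
  w \in Rm -> connect (adj T) x w = connect (adj T) y w.
Proof.
case/arborescenceP => /selectsP[nR _ uT] _ cxy wR.
have step e : e \in T -> connect (adj T) (src e) w = connect (adj T) (dst e) w.
  move=> eT; apply/idP/idP => [/connect_exit|]; last first.
    by apply: connect_trans; apply/connect1/gadjP; exists e.
  case=> [|e' e'T [s]]; first by apply: contraNneq (nR _ eT) => ->.
  by rewrite (uT _ _ e'T eT s).
case/connectP: cxy => q + ->; elim: q x => //= z q IH x /andP[/gadjP[e [eS <- <-]] /IH <-].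
move: eS; rewrite inE => /orP[/step //|/step].
by rewrite src_bar dst_bar.
Qed.

(** The roots reached are constant on a component, and a root, having no outgoing edge, reaches only
    itself. *)
Lemma arborescence_root_unique T v w w' : arbo T -> w \in Rm -> w' \in Rm ->
  connect (adj (undirected T)) v w -> connect (adj (undirected T)) v w' -> w = w'.
Proof.
move=> aT wR w'R cw cw'; apply/eqP; apply: contraT => ne.
have : connect (adj T) w' w.
  by rewrite -(arborescence_roots aT cw' wR) (arborescence_roots aT cw wR) connect0.
case/connect_exit; first by rewrite eq_sym.
have /arborescenceP[/selectsP[nR _ _] _] := aT.
by move=> e /nR /negP + [s _]; rewrite s.
Qed.

Lemma arborescence_forest T : arbo T ->
  ramified_spanning_forest src dst bar Rm #|Rm| (undirected T).
Proof.
move=> aT; have /andP[_ /forallP cT] := aT.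
have cU v : exists2 w, w \in Rm & connect (adj (undirected T)) v w.
  have /exists_inP[w wR cw] := cT v; exists w => //.
  exact: sub_adj (sub_undirected T) _ _ cw.
split=> [e|c||v].
- by rewrite undirected_bar.
- exact: arborescence_acyclic.
(* Each component contains exactly one root, so the components are counted by [Rm]. *)
- pose C v := [set w | connect (adj (undirected T)) v w].
  have -> : [set C v | v : V] = [set C v | v in Rm].
    apply/setP => A; apply/imsetP/imsetP => -[v vV ->]; last by exists v.
    have [w wR cw] := cU v; exists w => //; apply/setP => u; rewrite !inE.
    exact: same_connect (undirected_sym T) _ _ cw u.
  apply: card_in_imset => w w' wR w'R /setP/(_ w'); rewrite !inE connect0 => c.
  exact: arborescence_root_unique aT wR w'R (connect0 _ _) c.
- have [w wR cw] := cU v; apply/eqP/cards1P; exists w; apply/setP => w'.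
  rewrite !inE; apply/andP/eqP => [[w'R cw']|->]; last by [].
  exact: arborescence_root_unique aT w'R wR cw' cw.
Qed.

(** Induction on the height for [T2] of the source of an edge of [T1]. If the edge [e2] of [T2] at
    that source is not in [T1], its reverse is, and by induction lies in [T2]; but the height cannot
    drop along both [e2] and its reverse. *)
Lemma undirected_inj : {in arbo &, injective undirected}.
Proof.
suff sub T1 T2 : arbo T1 -> arbo T2 -> undirected T1 = undirected T2 -> T1 \subset T2.
  by move=> T1 T2 a1 a2 e; apply/eqP; rewrite eqEsubset !sub.
case/arborescenceP => /selectsP[n1 _ u1] _ /arborescenceP[/selectsP[n2 x2 u2] [h hh]] eqU.
suff IH k e : (h (src e) < k)%N -> e \in T1 -> e \in T2.
  by apply/subsetP => e; apply: IH (leqnn _).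
elim: k e => // k IH e hk eT1.
have [e2 e2T s] := x2 _ (n1 _ eT1).
have : e2 \in undirected T1 by rewrite eqU inE e2T.
rewrite inE => /orP[e2T1|be2]; first by rewrite -(u1 _ _ e2T1 eT1 s).
have lt := hh _ e2T.
have /hh : bar e2 \in T2 by apply: IH be2; rewrite src_bar; apply: leq_trans lt _; rewrite s.
by rewrite src_bar dst_bar ltnNge ltnW.
Qed.

(** A simple path in [S'] from the end of [e] back to its origin is closed up by [e]. Since [S'] is
    stable under [bar] and misses [e], the reverse of [e] is not on the path. *)
Lemma close_cycle (S S' : {set E}) e : S' \subset S ->
  (forall e, e \in S' -> bar e \in S') -> e \in S -> e \notin S' ->
  connect (adj S') (dst e) (src e) -> exists c, is_cycle src dst bar S c.
Proof.
move=> /subsetP subS barS eS eS' /connectP[q0 pq0 lq0].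
case/shortenP: pq0 lq0 => q pq uq _ lq.
(* [connect] only records vertices; as parallel edges may exist, edges have to be chosen along the
   path. *)
have lift : exists es : seq E, [/\ all (mem S') es, map dst es = q,
    path (fun e f => dst e == src f) e es & map src es = belast (dst e) q].
  elim: q (e) pq {uq lq} => [|z q IH] e1 /=; first by exists [::].
  case/andP => /gadjP[e2 [e2S s2 d2]]; rewrite -d2 => /IH[es [h1 h2 h3 h4]].
  by exists (e2 :: es); rewrite /= e2S h1 h2 h4 s2 eqxx.
case: lift => es [/allP esS dq pth sq]; exists (e :: es).
have uqs : uniq (map src (e :: es)).
  by rewrite /= sq lq; have := uq; rewrite lastI rcons_uniq.
have sd : map src es = belast (dst e) (map dst es) by rewrite dq.
(* If [f] at position [i] is the reverse of [f'] at position [j], distinctness of the vertices gives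
   both [i = j + 1] and [i + 1 = j]. *)
have nb f f' : f \in es -> f' \in es -> f != bar f'.
  move=> fes f'es; apply/eqP => ff'; move: uq; rewrite -dq => uq.
  pose i := index f es; pose j := index f' es.
  have ilt : (i < size es)%N by rewrite index_mem.
  have jlt : (j < size es)%N by rewrite index_mem.
  have srcE k : (k < size es)%N ->
      src (nth e es k) = nth (dst e) (dst e :: map dst es) k.
    move=> kl; rewrite -(nth_map _ (dst e)) // sd lastI nth_rcons size_belast size_map kl //.
  have dstE k : (k < size es)%N ->
      dst (nth e es k) = nth (dst e) (dst e :: map dst es) k.+1.
    by move=> kl; rewrite /= (nth_map e).
  have injd k l : (k <= size es)%N -> (l <= size es)%N ->
      nth (dst e) (dst e :: map dst es) k = nth (dst e) (dst e :: map dst es) l -> k = l.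
    by move=> kl ll /eqP; rewrite (nth_uniq (dst e) _ _ uq) /= ?size_map ?ltnS // => /eqP.
  have e1 : i = j.+1.
    by apply: (injd _ _ (ltnW ilt) jlt); rewrite -(srcE _ ilt) -(dstE _ jlt) /i /j !nth_index // ff' src_bar.
  have e2 : i.+1 = j.
    by apply: (injd _ _ ilt (ltnW jlt)); rewrite -(srcE _ jlt) -(dstE _ ilt) /i /j !nth_index // ff' dst_bar.
  by move: e2; rewrite e1 => /eqP; rewrite -addn2 -[X in _ == X]addn0 eqn_add2l.
have nbe f : f \in es -> e != bar f.
  by move=> /esS /barS bf; apply: contraNneq eS' => ->.
apply/and5P; split=> //.
- by rewrite /= eS; apply/allP => f /esS /subS.
- rewrite /= rcons_path pth /=; move: lq; rewrite -dq.
  case/lastP: (es) => [/= <-|es' f]; rewrite ?eqxx //.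
  by rewrite map_rcons !last_rcons => ->.
apply/andP; split; first exact: map_uniq uqs.
apply/allP => f; rewrite inE => /predU1P[->|fes]; apply/allP => f'; rewrite inE.
  by case/predU1P => [->|/nbe //]; rewrite eq_sym.
case/predU1P => [->|f'es]; last exact: nb.
by apply: contraNneq (nbe _ fes) => ->; rewrite barK.
Qed.

(** Every vertex reaches a root in [S], so [S] contains an arborescence [T]. The two ends of a
    further edge of [S] would lead to the same root within [T], and that edge would close a
    cycle. *)
Lemma forest_arborescence S : ramified_spanning_forest src dst bar Rm #|Rm| S ->
  exists2 T, arbo T & undirected T = S.
Proof.
case=> barS acyc _ uS.
have cS v : exists2 w, w \in Rm & connect (adj S) v w.
  have /eqP/cards1P[w wE] := uS v.
  have : w \in [set w in Rm | connect (adj S) v w] by rewrite wE set11.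
  by rewrite inE => /andP[]; exists w.
have [T aT subT] := sub_arborescence cS; exists T => //.
have subU : undirected T \subset S.
  apply/subsetP => e; rewrite inE => /orP[/(subsetP subT)//|/(subsetP subT)/barS].
  by rewrite barK.
apply/eqP; rewrite eqEsubset subU; apply/subsetP => e eS; apply: contraT => eU.
have /andP[_ /forallP cT] := aT.
have cTU := sub_adj (sub_undirected T).
have /exists_inP[w wR /cTU cw] := cT (dst e).
have /exists_inP[w' w'R /cTU cw'] := cT (src e).
have ww' : w = w'.
  have /eqP/cards1P[x xE] := uS (src e).
  have : w' \in [set x] by rewrite -xE inE w'R (sub_adj subU).
  have : w \in [set x].
    rewrite -xE inE wR; apply: connect_trans (sub_adj subU cw).
    by apply/connect1/gadjP; exists e.
  by rewrite !inE => /eqP-> /eqP->.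
have : connect (adj (undirected T)) (dst e) (src e).
  by apply: connect_trans cw _; rewrite ww' undirected_sym.
have barU e' : e' \in undirected T -> bar e' \in undirected T by rewrite undirected_bar.
by case/(close_cycle subU barU eS eU) => c; rewrite (negPf (acyc c)).
Qed.

Lemma Fcount_arborescences :
  Fcount src dst bar Rm #|Rm| = #|[set T | arbo T]|.
Proof.
rewrite -(@card_in_imset _ _ undirected [set T | arbo T]); last first.
  by move=> T T'; rewrite !inE; apply: undirected_inj.
congr #|pred_of_set _|; apply/setP => S; rewrite inE.
apply/asbP/imsetP => [/forest_arborescence[T aT <-]|[T + ->]].
  by exists T; rewrite ?inE.
by rewrite inE; apply: arborescence_forest.
Qed.

End Forests.

(** * The matrix-tree theorem *)

(** Multilinearity in the rows: [f] picks one summand in each row. *)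
Lemma det_sum_rows (R : comNzRingType) n (O : finType) (Q : 'I_n -> pred O)
    (B : 'I_n -> O -> 'I_n -> R) :
  \det (\matrix_(i, j) \sum_(o | Q i o) B i o j) =
  \sum_(f in family Q) \det (\matrix_(i, j) B i (f i) j).
Proof.
rewrite exchange_big /=; apply: eq_bigr => s _.
rewrite -big_distrr /=; congr (_ * _).
under eq_bigr do rewrite mxE; rewrite bigA_distr_big_dep.
by apply: eq_bigr => f _; apply: eq_bigr => i _; rewrite mxE.
Qed.

(** A permutation with a nonzero contribution never raises the height and lowers it at each moved
    index. The total height being invariant, only the identity remains. *)
Lemma det_height_trig (R : comNzRingType) n (h : 'I_n -> nat) (A : 'M[R]_n) :
  (forall i j, A i j != 0 -> i != j -> (h j < h i)%N) -> \det A = \prod_i A i i.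
Proof.
move=> tA; rewrite /determinant (bigD1 (1%g : 'S_n)) //= odd_perm1 mul1r [X in _ + X]big1 => [|s s1].
  by rewrite addr0; apply: eq_bigr => i _; rewrite perm1.
have [i /eqP z|nz] := pickP (fun i => A i (s i) == 0).
  by rewrite (bigD1 i) //= z mul0r mulr0.
have le i : (h (s i) <= h i)%N.
  have [<- //|ne] := eqVneq i (s i).
  by apply/ltnW/tA => //; rewrite nz.
case/eqP: s1; apply/permP => i; rewrite perm1; apply/eqP; apply: contraT => ne.
have lt : (h (s i) < h i)%N by apply: tA; rewrite ?nz // eq_sym.
suff : (\sum_i h (s i) < \sum_i h i)%N by rewrite [X in (_ < X)%N](reindex_perm s) ltnn.
rewrite (bigD1 i) //= [X in (_ < X)%N](bigD1 i) //= -addSn.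
by apply: leq_add lt _; apply: leq_sum.
Qed.

Section MatrixTree.
Variables (V E : finType) (src dst : E -> V) (Rm : {set V}).

(** Identity rows at the roots make the determinant equal to the minor of the Laplacian with the
    root rows and columns deleted. Loops cancel. *)
Definition rooted_laplacian (R : nzRingType) : 'M[R]_#|V| :=
  \matrix_(i, j) (if enum_val i \in Rm then (i == j)%:R
    else \sum_(e | src e == enum_val i) ((i == j)%:R - (dst e == enum_val j)%:R)).

(** The summands of row [i]: [None] stands for the identity row of a root, [Some e] for an edge
    leaving a non-root. *)
Let Q (i : 'I_#|V|) : pred (option E) := fun o =>
  if o is Some e then (enum_val i \notin Rm) && (src e == enum_val i)
  else enum_val i \in Rm.
Let B (i : 'I_#|V|) (o : option E) (j : 'I_#|V|) : int :=
  (i == j)%:R - (if o is Some e then (dst e == enum_val j)%:R else 0).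
Let sel (f : {ffun 'I_#|V| -> option E}) : {set E} :=
  [set e | f (enum_rank (src e)) == Some e].

Let rooted_laplacianE :
  rooted_laplacian int = \matrix_(i, j) \sum_(o | Q i o) B i o j.
Proof.
apply/matrixP => i j; rewrite !mxE.
rewrite (bigID (fun o => o == None)) /= /Q /B; case: ifPn => iR /=.
  by rewrite (big_pred1 None) => [|[e|]] //=; rewrite subr0 big1 ?addr0 // => -[e|].
rewrite [X in _ = X + _]big1 => [|o]; last by case: o => [e|]; rewrite ?andbF.
rewrite add0r [RHS](reindex_omap (fun e => Some e) id) => [|[e|] //=].
by apply: eq_bigl => e; rewrite /= andbT eqxx andbT.
Qed.

Let selP f e : f \in family Q -> f (enum_rank (src e)) == Some e ->
  (src e \notin Rm).
Proof.
by move/familyP/(_ (enum_rank (src e))) => + /eqP fe; rewrite fe /= unfold_in /= enum_rankK => /andP[].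
Qed.

Let familyE f i : f \in family Q ->
  if enum_val i \in Rm then f i = None else
    exists e, [/\ f i = Some e, src e = enum_val i & e \in sel f].
Proof.
move/familyP/(_ i); rewrite unfold_in; case fi: (f i) => [e|] /=; last by move=> ->.
case/andP => /negPf-> /eqP se; exists e; split=> //.
by rewrite inE se enum_valK fi.
Qed.

Let sel_selects f : f \in family Q -> selects_out_edges src Rm (sel f).
Proof.
move=> fQ; apply: selectsI => [e|v vR|e e'].
- by rewrite inE; apply: selP.
- by have := familyE (enum_rank v) fQ; rewrite enum_rankK (negPf vR) => -[e [_ ? ?]]; exists e.
- by rewrite !inE => /eqP h1 /eqP h2 s; apply: Some_inj; rewrite -h1 -h2 s.
Qed.

Let sel_inj : {in family Q &, injective sel}.
Proof.
move=> f f' fQ f'Q ff'; apply/ffunP => i.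
have := familyE i fQ; have := familyE i f'Q; case: ifP => _; first by move=> -> ->.
case=> e' [fe' _ _] [e [fe s]].
by rewrite ff' inE s enum_valK fe fe' => /eqP.
Qed.

Let sel_surj T : selects_out_edges src Rm T -> exists2 f, f \in family Q & sel f = T.
Proof.
case/selectsP => nR xT uT.
pose f := [ffun i : 'I_#|V| => [pick e in T | src e == enum_val i]].
exists f.
  apply/familyP => i; rewrite ffunE; case: pickP => [e /andP[eT /eqP s]|no] /=.
    by rewrite unfold_in /= -s eqxx (nR _ eT).
  rewrite unfold_in /=; apply: contraT => /xT[e eT s].
  by have := no e; rewrite eT s eqxx.
apply/setP => e; rewrite inE ffunE enum_rankK; case: pickP => [e' /andP[e'T /eqP s]|/(_ e)].
  by apply/eqP/idP => [[<-]//|eT]; rewrite (uT _ _ e'T eT s).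
by rewrite eqxx andbT => ->.
Qed.

(** For an arborescence the height makes the matrix triangular, with unit diagonal because no loop
    is selected. Otherwise some vertex reaches no root and the matrix is singular. *)
Let det_sel f : f \in family Q ->
  \det (\matrix_(i, j) B i (f i) j) = (arborescence src dst Rm (sel f))%:R.
Proof.
move=> fQ; have sT := sel_selects fQ.
have [/arborescenceP[_ [h hT]]|naT] := boolP (arborescence _ _ _ _).
  rewrite (@det_height_trig _ _ (h \o enum_val)) => [|i j]; rewrite ?mxE.
    rewrite big1 // => i _; rewrite mxE /B eqxx.
    have := familyE i fQ; case: ifP => _; first by move=> ->; rewrite subr0.
    case=> e [-> s /hT]; rewrite s; case: eqP => [->|]; rewrite ?ltnn ?subr0 //.
  rewrite /B => + ne; rewrite (negPf ne) sub0r oppr_eq0 /=.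
  have := familyE i fQ; case: ifP => _; first by move=> ->; rewrite eqxx.
  case=> e [-> s /hT]; rewrite s; case: (dst e =P enum_val j) => [->|] //; rewrite eqxx.
apply/eqP; rewrite -det_tr; apply/det0P.
(* A kernel vector: the indicator of the vertices from which no root is reached. *)
pose lost v := ~~ [exists w in Rm, connect (gadj src dst (sel f)) v w].
exists (\row_j (lost (enum_val j))%:R).
  move: naT; rewrite /arborescence sT /= negb_forall => /existsP[v lv].
  apply/eqP => /rowP/(_ (enum_rank v)); rewrite !mxE enum_rankK /lost lv.
  by apply/eqP; rewrite oner_eq0.
apply/rowP => i; rewrite !mxE.
under eq_bigr do rewrite !mxE /B mulrBr.
rewrite sumrB (bigD1 i) //= eqxx mulr1 big1 ?addr0; last first.
  by move=> j ne; rewrite eq_sym (negPf ne) mulr0.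
have := familyE i fQ; case: ifP => [iR|iR [e [-> s eT]]].
  move=> ->; rewrite big1 ?subr0 => [|j _]; last by rewrite mulr0.
  by rewrite /lost; case: exists_inP => // -[]; exists (enum_val i).
rewrite (bigD1 (enum_rank (dst e))) //= enum_rankK eqxx mulr1 big1 ?addr0; last first.
  move=> j ne; case: eqP => [de|]; rewrite ?mulr0 //.
  by rewrite de enum_valK eqxx in ne.
apply/eqP; rewrite subr_eq0; apply/eqP; congr (nat_of_bool (~~ _))%:R.
have [nR _ uT] := selectsP sT.
apply/exists_inP/exists_inP => -[w wR cw]; exists w => //.
  case/connect_exit: cw => [|e' e'T [s' cw]]; first by apply: contraFneq iR => ->.
  by rewrite -(uT _ _ e'T eT) // s'.
by apply: connect_trans cw; apply/connect1/gadjP; exists e.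
Qed.

Theorem det_rooted_laplacian :
  \det (rooted_laplacian int) = #|[set T | arborescence src dst Rm T]|%:R.
Proof.
rewrite rooted_laplacianE det_sum_rows (eq_bigr _ det_sel) -natr_sum; congr _%:R.
rewrite -big_mkcondr sum1_card -(card_in_imset (f := sel)); last first.
  by move=> f f' /andP[fQ _] /andP[f'Q _]; apply: sel_inj.
apply: eq_card => T; rewrite inE; apply/imsetP/idP => [[f /andP[_ aT] ->] //|aT].
have /andP[/sel_surj[f fQ fT] _] := aT.
by exists f; rewrite // unfold_in /= fT aT andbT.
Qed.

End MatrixTree.

(** * Laplacians of cyclic covers *)

(** Rows and columns are permuted alike, so the signs cancel. The sizes are only propositionally
    equal, to allow a change of enumeration. *)
Lemma det_mxsub_inj (R : comNzRingType) n m (f : 'I_n -> 'I_m) (A : 'M[R]_m) :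
  n = m -> injective f -> \det (mxsub f f A) = \det A.
Proof.
move=> enm; subst n => f_inj; pose s := perm f_inj.
have -> : mxsub f f A = row_perm s (col_perm s A).
  by apply/matrixP => i j; rewrite !mxE !permE.
rewrite row_permE col_permE !det_mulmx !det_perm odd_permV mulrCA -expr2 sqrr_sign.
by rewrite mulr1.
Qed.

Lemma det_mxdiag (R : comNzRingType) n (p_ : 'I_n -> nat)
    (B_ : forall i, 'M[R]_(p_ i)) :
  \det (\mxdiag_i B_ i) = \prod_i \det (B_ i).
Proof.
elim: n p_ B_ => [|n IH] p_ B_.
  rewrite [RHS]big_ord0; move: (\mxdiag_i B_ i); rewrite big_ord0 => A; exact: det_mx00.
rewrite mxdiag_recl [RHS]big_ord_recl -IH -(det_ublock _ 0).
by move: mxsize_recl (block_mx _ _ _ _) => e M; case: _ / e M.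
Qed.

Lemma det_pair_diag (R : comNzRingType) (J : finType) N (B_ : 'I_N -> 'M[R]_#|J|) :
  \det (\matrix_(x < #|{: J * 'I_N}|, y < #|{: J * 'I_N}|)
     (((enum_val x).2 == (enum_val y).2)%:R *
      B_ (enum_val x).2 (enum_rank (enum_val x).1) (enum_rank (enum_val y).1)))
  = \prod_k \det (B_ k).
Proof.
rewrite -det_mxdiag.
pose f (x : 'I_(\sum_(k < N) #|J|)) : 'I_#|{: J * 'I_N}| :=
  enum_rank (enum_val (tagnat.sig2 x), tagnat.sig1 x).
rewrite -(@det_mxsub_inj _ _ _ f).
- congr (\det _); apply/matrixP => x y; rewrite !mxE !enum_rankK /=.
  rewrite !enum_valK; case: eqP => [_|_]; last by rewrite mul0r mxE.
  by rewrite mul1r conform_mx_id.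
- by rewrite sum_nat_const card_prod !card_ord mulnC.
- move=> x y /enum_rank_inj[/enum_val_inj e2 e1].
  apply: (@tagnat.sig_inj _ (fun _ => #|J|)); rewrite !tagnat.sigE12.
  by move: (tagnat.sig1 x) (tagnat.sig2 x) e1 e2 => i j -> ->.
Qed.

Lemma sum_enum_val (R : nmodType) (T : finType) (F : T -> R) :
  \sum_(i < #|T|) F (enum_val i) = \sum_x F x.
Proof. by rewrite [RHS](reindex _ (onW_bij _ (@enum_val_bij T))). Qed.

Lemma sum_pick (R : nzRingType) (T : finType) (x : T) (F : T -> R) :
  \sum_y (x == y)%:R * F y = F x.
Proof.
rewrite (bigD1 x) //= eqxx mul1r big1 ?addr0 // => y.
by rewrite eq_sym => /negPf->; rewrite mul0r.
Qed.

(** The Laplacian as an operator on functions of vertices, the form in which it is applied to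
    characters. *)
Lemma rooted_laplacian_sum (V E : finType) (src dst : E -> V) (Rm : {set V})
    (R : nzRingType) i (F : V -> R) :
  \sum_j rooted_laplacian src dst Rm R i j * F (enum_val j) =
  if enum_val i \in Rm then F (enum_val i)
  else \sum_(e | src e == enum_val i) (F (enum_val i) - F (dst e)).
Proof.
have eqV (j : 'I_#|V|) : (i == j) = (enum_val i == enum_val j).
  by rewrite (inj_eq enum_val_inj).
under eq_bigr do rewrite mxE; case: ifP => _.
  under eq_bigr do rewrite eqV.
  by rewrite (sum_enum_val (fun y => (enum_val i == y)%:R * F y)) sum_pick.
under eq_bigr do rewrite big_distrl.
rewrite exchange_big /=; apply: eq_bigr => e _.
under eq_bigr do rewrite mulrBl eqV; rewrite sumrB.
rewrite (sum_enum_val (fun y => (enum_val i == y)%:R * F y)) sum_pick.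
by rewrite (sum_enum_val (fun y => (dst e == y)%:R * F y)) sum_pick.
Qed.

Section Cover.
Variables (V E : finType) (src dst : E -> V) (Rm : {set V}) (a : E -> nat) (N : nat).

Local Notation Y := (V * 'I_N)%type.

Definition cover_src (x : E * 'I_N) : V * 'I_N := (src x.1, x.2).
Definition cover_dst (x : E * 'I_N) : V * 'I_N := (dst x.1, addI x.2 (a x.1)).
Definition cover_ram : {set V * 'I_N} := [set y | y.1 \in Rm].

(** The transpose of [M_alpha] with [z] in place of [gamma] and natural exponents [a e]. *)
Definition voltage_mx (R : nzRingType) (z : R) : 'M[R]_#|V| :=
  \matrix_(i, j) (if enum_val i \in Rm then (i == j)%:R
    else \sum_(e | src e == enum_val i)
           ((i == j)%:R - (dst e == enum_val j)%:R * z ^+ a e)).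

(* The Vandermonde matrix of the roots of unity block-diagonalises the translation-invariant Laplacian. *)
Lemma det_cover_laplacian (F : fieldType) (z : F) : N.-primitive_root z ->
  \det (rooted_laplacian cover_src cover_dst cover_ram F) =
  \prod_(k < N) \det (voltage_mx (z ^+ k)).
Proof.
move=> pz; rewrite -det_pair_diag; set D := (X in _ = \det X).
set L := rooted_laplacian _ _ _ _.
pose W : 'M[F]_#|{: Y}| := \matrix_(x < #|{: Y}|, y < #|{: Y}|)
  (((enum_val x).1 == (enum_val y).1)%:R * z ^+ ((enum_val y).2 * (enum_val x).2)).
(* The column of [W] at [(v', k)] is the character [g |-> z ^+ (k * g)] on the fibre over [v'].
   Translating by a voltage multiplies it by a power of [z ^+ k]; the reduction modulo [N] in [addI]
   is harmless as [z] has order [N]. *)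
have LW : L *m W = W *m D.
  apply/matrixP => x y; rewrite !mxE.
  under eq_bigr do rewrite [W _ _]mxE.
  apply: etrans (rooted_laplacian_sum cover_src cover_dst cover_ram x (fun t : Y =>
    (t.1 == (enum_val y).1)%:R * z ^+ ((enum_val y).2 * t.2))) _.
  under [RHS]eq_bigr do rewrite [W _ _]mxE [D _ _]mxE.
  rewrite (sum_enum_val (fun t : Y => ((enum_val x).1 == t.1)%:R * z ^+ (t.2 * (enum_val x).2) *
    ((t.2 == (enum_val y).2)%:R *
      (voltage_mx (z ^+ t.2)) (enum_rank t.1) (enum_rank (enum_val y).1)))).
  move: (enum_val x) (enum_val y) => [v g] [v' k] {x y} /=.
  rewrite -(pair_bigA _ (fun v2 (k2 : 'I_N) => (v == v2)%:R * z ^+ (k2 * g) *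
    ((k2 == k)%:R * voltage_mx (z ^+ k2) (enum_rank v2) (enum_rank v')))) /=.
  rewrite exchange_big (bigD1 k) //= [X in _ + X]big1 ?addr0; last first.
    by move=> k2 /negPf ne; rewrite big1 // => v2 _; rewrite ne mul0r mulr0.
  under [RHS]eq_bigr do rewrite eqxx mul1r -mulrA.
  rewrite sum_pick mxE !enum_rankK (inj_eq enum_rank_inj) inE /=.
  case: ifP => _; first by rewrite mulrC.
  rewrite (reindex_onto (fun e : E => (e, g)) fst) /=; last first.
    by move=> [e g'] /= /eqP[_ ->].
  rewrite big_distrr /=; apply: eq_big => e.
    by rewrite /cover_src /= xpair_eqE !eqxx !andbT.
  move=> _; rewrite mulrBr mulrC; congr (_ - _); rewrite mulrCA; congr (_ * _).
  rewrite -exprM -exprD -mulnDr; apply/eqP; rewrite (eq_prim_root_expr pz) /=.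
  by rewrite modnMmr.
(* On each fibre [W] is the Vandermonde matrix of the distinct powers of [z]; its inverse is
   assembled fibrewise. *)
have WU : W \in unitmx.
  pose Z := Vandermonde N (\row_(k < N) z ^+ k).
  have ZU : Z \in unitmx.
    rewrite unitmxE det_Vandermonde unitfE; apply/prodf_neq0 => i _.
    apply/prodf_neq0 => j ij; rewrite !mxE subr_eq0 (eq_prim_root_expr pz) !modn_small //.
    by rewrite neq_ltn ij orbT.
  suff /mulmx1_unit[] : W *m (\matrix_(x < #|{: Y}|, y < #|{: Y}|) (((enum_val x).1 == (enum_val y).1)%:R *
     invmx Z (enum_val x).2 (enum_val y).2)) = 1%:M by [].
  apply/matrixP => x y; rewrite !mxE; under eq_bigr do rewrite !mxE.
  rewrite (sum_enum_val (fun t : Y => ((enum_val x).1 == t.1)%:R * z ^+ (t.2 * (enum_val x).2) *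
    ((t.1 == (enum_val y).1)%:R * invmx Z t.2 (enum_val y).2))).
  rewrite -(inj_eq enum_val_inj).
  move: (enum_val x) (enum_val y) => [v g] [v' k] {x y} /=.
  rewrite -(pair_bigA _ (fun v2 (k2 : 'I_N) => (v == v2)%:R * z ^+ (k2 * g) *
    ((v2 == v')%:R * invmx Z k2 k))) /=.
  under eq_bigr do [under eq_bigr do rewrite -mulrA]; under eq_bigr do rewrite -big_distrr.
  rewrite sum_pick; under eq_bigr do rewrite mulrCA; rewrite -big_distrr /=.
  have /matrixP/(_ g k) := mulmxV ZU; rewrite !mxE => eZ.
  rewrite xpair_eqE -mulnb natrM -eZ; congr (_ * _); apply: eq_bigr => k2 _.
  by rewrite !mxE exprM.
have /eqP := congr1 determinant LW; rewrite !det_mulmx mulrC.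
have dW : \det W != 0 by rewrite -unitfE -unitmxE.
by move/eqP/(mulfI dW).
Qed.

End Cover.

(** * The layers of the tower *)

(** Only roots are identified, and roots emit no selected edge. So outgoing edges correspond,
    heights pull back along [q] and paths push forward. *)
Lemma arborescence_quotient (X Y E : finType) (src dst : E -> Y) (q : Y -> X)
    (RX : {set X}) (RY : {set Y}) (T : {set E}) :
  (forall y, (q y \in RX) = (y \in RY)) ->
  (forall y y', y \notin RY -> q y = q y' -> y = y') ->
  (forall x, exists y, q y = x) ->
  arborescence (q \o src) (q \o dst) RX T = arborescence src dst RY T.
Proof.
move=> qR q_inj q_surj; apply/idP/idP => [/arborescenceP[/selectsP[h1 h2 h3] [h hT]]|].
  apply/arborescenceP; split; last by exists (h \o q).
  apply: selectsI => [e /h1|y yR|e e' eT e'T s]; first by rewrite /= qR.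
    have /h2[e eT /= se] : q y \notin RX by rewrite qR.
    by exists e; rewrite // (q_inj _ _ yR (esym se)).
  by apply: h3; rewrite //= s.
case/andP => /selectsP[h1 h2 h3] /forallP cT; apply/andP; split.
  apply: selectsI => [e /h1|x xR|e e' eT e'T /= s]; first by rewrite /= qR.
    have [y yx] := q_surj x; have /h2[e eT se] : y \notin RY by rewrite -qR yx.
    by exists e; rewrite //= se.
  by apply: h3 => //; apply: q_inj s; apply: h1.
apply/forallP => x; have [y <-] := q_surj x; have /exists_inP[w wR] := cT y.
case/connectP => r pr lw; apply/exists_inP; exists (q w); first by rewrite qR.
apply/connectP; exists (map q r); last by rewrite last_map lw.
rewrite path_map; apply: sub_path pr => u u' /gadjP[e [eT <- <-]].
by apply/gadjP; exists e.
Qed.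

Lemma val_lvert (V : finType) (Rm : {set V}) N v (g : 'I_N) :
  val (lvert Rm v g) = if v \in Rm then inr v else inl (v, g).
Proof.
(* The test is generalised together with its proof, so that the dependent match reduces. *)
suff aux b (h : (v \in Rm) = b) : val ((if b as b return (v \in Rm) = b -> LV Rm N
    then fun h => exist _ (inr v) h else fun h => exist _ (inl (v, g)) (negbT h)) h) =
    if b then inr v else inl (v, g) by exact: aux.
by case: b h.
Qed.

Section LayerCount.
Variables (p : nat) (V E : finType) (src dst : E -> V) (bar : E -> E).
Variables (Rm : {set V}) (alpha : E -> zp p) (n : nat).
Hypothesis p_gt0 : (0 < p)%N.

Let q (y : V * 'I_(p ^ n)) : LV Rm (p ^ n) := lvert Rm y.1 y.2.
Let RY : {set V * 'I_(p ^ n)} := cover_ram Rm (p ^ n).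

Let q_ram y : (q y \in layer_ram p Rm n) = (y \in RY).
Proof. by rewrite !inE val_lvert; case: ifP. Qed.

Let q_inj y y' : y \notin RY -> q y = q y' -> y = y'.
Proof.
rewrite inE => yR /(congr1 val); rewrite !val_lvert (negPf yR); case: ifP => // _ [].
by case: y y' {yR} => [? ?] [? ?] /= -> ->.
Qed.

Let q_surj x : exists y, q y = x.
Proof.
have N0 : (0 < p ^ n)%N by rewrite expn_gt0 p_gt0.
case: x => -[[v g]|v] vP.
  by exists (v, g); apply: val_inj; rewrite val_lvert /= [_ \in _](negPf vP).
by exists (v, Ordinal N0); apply: val_inj; rewrite val_lvert /= [_ \in _]vP.
Qed.

Lemma card_layer_ram : #|layer_ram p Rm n| = #|Rm|.
Proof.
have N0 : (0 < p ^ n)%N by rewrite expn_gt0 p_gt0.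
rewrite -(@card_in_imset _ _ (fun v => q (v, Ordinal N0)) Rm).
  apply: eq_card => x; apply/idP/imsetP => [|[v vR ->]]; last by rewrite q_ram inE.
  have [[v g] <-] := q_surj x; rewrite q_ram inE /= => vR; exists v => //.
  by apply: val_inj; rewrite !val_lvert vR.
by move=> v w vR wR /(congr1 val); rewrite !val_lvert vR wR => -[].
Qed.

Lemma layer_is_graph : is_graph src dst bar -> voltage bar alpha ->
  is_graph (@layer_src p V E src Rm n) (@layer_dst p V E dst Rm alpha n)
    (@layer_bar p E bar alpha n).
Proof.
case=> barK bar_neq src_bar volt; split=> [[e g]|[e g]|[e g]].
- rewrite /layer_bar /= barK; congr (_, _); apply: val_inj => /=.
  rewrite modnDml -addnA -modnDmr addnC [(zres _ _ + zres _ _)%N]addnC (volt e n).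
  by rewrite add0n modn_small.
- by rewrite xpair_eqE (negPf (bar_neq e)).
- by rewrite /layer_src /layer_dst /= src_bar.
Qed.

Let arborescence_layer T :
  arborescence (@layer_src p V E src Rm n) (@layer_dst p V E dst Rm alpha n)
    (layer_ram p Rm n) T =
  arborescence (cover_src src (N:=p ^ n)) (cover_dst dst (fun e => zres (alpha e) n) (N:=p ^ n))
    RY T.
Proof.
exact: (@arborescence_quotient _ _ _ (cover_src src (N:=p ^ n))
  (cover_dst dst (fun e => zres (alpha e) n) (N:=p ^ n)) q _ _ T q_ram q_inj q_surj).
Qed.

Lemma layer_F_det : is_graph src dst bar -> voltage bar alpha ->
  \det (rooted_laplacian (cover_src src (N:=p ^ n))
     (cover_dst dst (fun e => zres (alpha e) n) (N:=p ^ n)) RY int)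
  = (layer_F src dst bar Rm alpha n #|Rm|)%:R.
Proof.
move=> gG vG; rewrite det_rooted_laplacian /layer_F -card_layer_ram.
rewrite Fcount_arborescences; last exact: layer_is_graph.
by congr _%:R; apply: eq_card => T; rewrite !inE arborescence_layer.
Qed.

(** Since [logn p 0] is 0 by convention, multiplicativity of the valuation needs a nonzero count. *)
Lemma layer_F_gt0 : is_graph src dst bar -> voltage bar alpha -> (0 < #|Rm|)%N ->
  gconnected (@layer_src p V E src Rm n) (@layer_dst p V E dst Rm alpha n) ->
  (0 < layer_F src dst bar Rm alpha n #|Rm|)%N.
Proof.
move=> gG vG; rewrite -card_layer_ram => /card_gt0P[w wR] conn.
rewrite /layer_F Fcount_arborescences; last exact: layer_is_graph.
have [|T aT _] := @sub_arborescence _ _ (@layer_src p V E src Rm n)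
  (@layer_dst p V E dst Rm alpha n) (layer_ram p Rm n) setT.
  by move=> v; exists w.
by apply/card_gt0P; exists T; rewrite inE.
Qed.

End LayerCount.

(** * Norms of integer polynomials *)

Lemma horner_char_poly (R : comNzRingType) n (A : 'M[R]_n) (b : R) :
  (char_poly A).[b] = \det (b%:M - A).
Proof.
rewrite -horner_evalE -det_map_mx; congr (\det _); apply/matrixP => i j.
by rewrite !mxE rmorphB /= !horner_evalE hornerC hornerMn hornerX.
Qed.

(* Factor [q] rather than the characteristic polynomial: the determinant of [q(A)]
   is then a product of values of the characteristic polynomial. *)
Lemma det_horner_mx_roots (F : closedFieldType) n (A : 'M[F]_n.+1) (rs : seq F) q :
  char_poly A = \prod_(z <- rs) ('X - z%:P) ->
  \det (horner_mx A q) = \prod_(z <- rs) q.[z].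
Proof.
move=> cA; have [bs ->] := closed_field_poly_normal q; set c := lead_coef q.
have sz : size rs = n.+1.
  by apply/eqP; rewrite -eqSS -(size_prod_XsubC rs id) -cA size_char_poly.
rewrite linearZ /= rmorph_prod /= detZ.
under eq_big_seq do rewrite rmorphB /= horner_mx_X horner_mx_C.
rewrite (big_morph (@determinant _ _) (@det_mulmx _ _) (@det1 _ _)).
under [RHS]eq_bigr do rewrite hornerZ horner_prod.
rewrite big_split /= big_const_seq count_predT iter_mulr_1 sz; congr (_ * _).
rewrite exchange_big /=; apply: eq_bigr => b _.
under eq_bigr do rewrite hornerXsubC.
have -> : A - b%:M = (-1) *: (b%:M - A) by rewrite scaleN1r opprB.
rewrite detZ -horner_char_poly cA horner_prod -sz.
under eq_bigr do rewrite hornerXsubC -opprB -mulN1r.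
rewrite big_split /= big_const_seq count_predT iter_mulr_1 mulrA -exprMn.
by rewrite mulrNN mulr1 expr1n mul1r.
Qed.

Local Notation ev q z := (map_poly (intr : int -> algC) q).[z].

(** The norm is [\det q(A)] for the companion matrix [A] of [g], hence an integer. If [g] is a power
    of ['X] modulo [p] and [p] does not divide [q.[0]], then [q] is coprime to [g] modulo [p], and
    Bezout with Cayley-Hamilton inverts [q(A)]. *)
Lemma norm_from_roots (g : {poly int}) (rs : seq algC) (q : {poly int}) :
  g \is monic -> (1 < size g)%N -> map_poly intr g = \prod_(z <- rs) ('X - z%:P) ->
  exists N : int, N%:~R = \prod_(z <- rs) ev q z /\
   forall p, prime p -> map_poly (intr : int -> 'F_p) g = 'X^((size g).-1) ->
     ~~ (p%:Z %| q.[0])%Z -> ~~ (p%:Z %| N)%Z.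
Proof.
move=> mg sg grs.
have [d sz] : exists d, (size g).-1 = d.+1 by case: (size g) sg => [|[|d]] // _; exists d.
have [A cA] : exists A : 'M[int]_d.+1, char_poly A = g.
  have : exists A : 'M[int]_((size g).-1), char_poly A = g.
    by exists (companionmx g); apply: companionmxK.
  by rewrite sz.
exists (\det (horner_mx A q)); split.
  rewrite -det_map_mx map_horner_mx; apply: det_horner_mx_roots.
  by rewrite -map_char_poly cA.
move=> p pp gp; have pF := pchar_Fp pp.
rewrite !(dvdz_pcharf pF) => q0.
rewrite -det_map_mx map_horner_mx -unitfE -unitmxE.
set A' := map_mx _ A; set q' := map_poly _ q.
have cA' : char_poly A' = 'X^((size g).-1) by rewrite -map_char_poly cA.
have : coprimep q' (char_poly A').
  rewrite cA'; apply: coprimep_expr; rewrite coprimepX /root.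
  by rewrite -[0](rmorph0 intr) horner_map.
case/Bezout_eq1_coprimepP => -[u v] /= /(congr1 (horner_mx A')).
rewrite rmorphD !rmorphM /= Cayley_Hamilton mulr0 addr0 rmorph1.
by case/mulmx1_unit.
Qed.

Lemma poly_divisible (d : int) (q : {poly int}) :
  (forall i, (d %| q`_i)%Z) -> exists w, q = d%:P * w.
Proof.
move=> dq; exists (\poly_(i < size q) (q`_i %/ d)%Z); apply/polyP => i.
rewrite coefCM coef_poly; case: ltnP => [_|le]; last by rewrite mulr0 nth_default.
by rewrite mulrC divzK.
Qed.

(* At a root [z] of [P] one has [p * w(z) = - z ^+ phi]; multiplying [D(z)] by [w(z)], whose
   norm is prime to [p], turns it into [p ^ mu * z ^+ lam * G(z)] with [G(0) = Ut(0)]. *)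
Lemma eisenstein_norm p mu lam (P w D Ut c A B : {poly int}) (rs : seq algC)
    (phi := (size P).-1) :
  prime p -> P \is monic -> (lam < phi)%N -> P = 'X^phi + p%:Z%:P * w -> w.[0] = 1 ->
  map_poly intr P = \prod_(z <- rs) ('X - z%:P) ->
  ~~ (p%:Z %| Ut.[0])%Z ->
  D = (p ^ mu)%:Z%:P * (Ut * ('X^lam + p%:Z%:P * c)) + (p ^ mu.+2)%:Z%:P * A
      + 'X^(mu.+2 * phi) * B ->
  exists N : int, [/\ N%:~R = \prod_(z <- rs) ev D z, N != 0
                    & logn p `|N| = (mu * phi + lam)%N].
Proof.
move=> pp mP lphi PE w0 Prs U0; move Em2: mu.+2 => m2 DE.
have phi0 : (0 < phi)%N by apply: leq_ltn_trans lphi.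
have sP : (1 < size P)%N by move: phi0; rewrite /phi; case: (size P) => [|[|]].
have pF := pchar_Fp pp.
have redP : map_poly (intr : int -> 'F_p) P = 'X^phi.
  rewrite [in LHS]PE rmorphD rmorphM /= map_polyXn map_polyC /=.
  by rewrite -pmulrn pcharf0 // mul0r addr0.
have szrs : size rs = phi.
  have := size_prod_XsubC rs id; rewrite -Prs size_map_inj_poly //; last exact: intr_inj.
  by rewrite /phi => ->.
(* The sign comes from [z ^+ (mu.+2 * phi) = (- (p * w(z))) ^+ mu.+2] at a root [z]. *)
pose s : {poly int} := (-1) ^+ mu.
pose G := Ut * w - 'X^(phi - lam) * (Ut * c + p%:Z%:P * A + p%:Z%:P * (s * w ^+ m2 * B)).
have G0 : ~~ (p%:Z %| G.[0])%Z.
  rewrite /G hornerD hornerN !hornerM w0 mulr1 hornerXn expr0n subn_eq0 leqNgt lphi.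
  by rewrite mul0r subr0.
have [Nw [NwE /(_ _ pp redP)]] := norm_from_roots w mP sP Prs.
rewrite w0 => /(_ _) Nw0; have {}Nw0 : ~~ (p%:Z %| Nw)%Z.
  by apply: Nw0; rewrite dvdz1 /= eqn_leq leqNgt prime_gt1.
have [NG [NGE /(_ _ pp redP G0) NG0]] := norm_from_roots G mP sP Prs.
have [ND [NDE _]] := norm_from_roots D mP sP Prs.
have [NX [NXE _]] := norm_from_roots 'X mP sP Prs.
(* Up to sign, the product of the roots is the constant term [P.[0] = p * w.[0] = p]. *)
have aNX : `|NX|%N = p.
  have : (p%:Z)%:~R = (-1) ^+ size rs * NX%:~R :> algC.
    rewrite NXE.
    have -> : p%:Z%:~R = ev P 0.
      rewrite -[0](rmorph0 intr) horner_map /= PE hornerD hornerM hornerC w0 mulr1.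
      by rewrite hornerXn expr0n eqn0Ngt phi0 add0r.
    rewrite Prs horner_prod; under eq_bigr do rewrite hornerXsubC sub0r -mulN1r.
    rewrite big_split /= big_const_seq count_predT iter_mulr_1; congr (_ * _).
    by apply: eq_bigr => z _; rewrite map_polyX hornerX.
  have -> : (-1 : algC) ^+ size rs = ((-1) ^+ size rs)%:~R by rewrite rmorphXn /= rmorphN1.
  rewrite -rmorphM /= => /intr_inj /(congr1 absz); rewrite abszMsign.
  by move=> <-.
(* This is the product over the [phi] roots of [w(z) * D(z) = p ^ mu * z ^+ lam * G(z)]. *)
have key : Nw * ND = (p%:Z ^+ (mu * phi)) * NX ^+ lam * NG.
  apply: (@intr_inj algC); rewrite !rmorphM !rmorphXn /= NwE NDE NXE NGE.
  rewrite mulnC -szrs [in X in _ = X * _ * _]exprM exprAC -prodrXl.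
  rewrite -(iter_mulr_1 (size rs)) -(count_predT rs) -big_const_seq -!big_split /=.
  apply: eq_big_seq => z zrs.
  have Pz : ev P z = 0 by apply/rootP; rewrite Prs root_prod_XsubC.
  have {}Pz : z ^+ lam * z ^+ (phi - lam) = - (p%:R * ev w z).
    move: Pz; rewrite PE rmorphD rmorphM /= map_polyXn map_polyC /= !hornerE.
    by rewrite -exprD subnKC 1?ltnW // => /eqP; rewrite addr_eq0 => /eqP.
  have zz : z ^+ (m2 * phi) = (- (p%:R * ev w z)) ^+ m2.
    by rewrite mulnC exprM -Pz -exprD subnKC // ltnW.
  rewrite DE /G /s !(rmorphD, rmorphN, rmorphM, rmorphXn) /= ?rmorph1 !map_polyC map_polyX /=.
  rewrite !(hornerD, hornerN, hornerM, hornerC, horner_exp, hornerX) zz.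
  move: (ev Ut z) (ev w z) (ev c z) (ev A z) (ev B z) Pz => u W c' a b.
  rewrite -Em2 exprNn !exprMn -!pmulrn !exprS !mulN1r opprK.
  (* With all values abstracted, [Pz : t * y = - (r * W)] is the only relation left; after its
     substitution the claim is a ring identity. *)
  move: (z ^+ lam) (z ^+ (phi - lam)) (p%:R : algC) => t y r Pz.
  rewrite -[_ * t * _]mulrA mulrBr [t * (y * _)]mulrA Pz.
  by ring.
have aN x : ~~ (p%:Z %| x)%Z -> logn p `|x| = 0%N.
  by rewrite dvdzE /= lognE => /negPf->; rewrite !andbF.
have nz x : ~~ (p%:Z %| x)%Z -> x != 0 by apply: contraNneq => ->; rewrite dvdz0.
have p0 : p%:Z != 0 by rewrite eqz_nat -lt0n prime_gt0.
have NX0 : NX != 0 by rewrite -absz_eq0 aNX -lt0n prime_gt0.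
have rhs0 : Nw * ND != 0 by rewrite key !mulf_neq0 ?expf_neq0 // nz.
have ND0 : ND != 0 by move: rhs0; rewrite mulf_eq0 negb_or => /andP[].
exists ND; split=> //.
have : logn p `|Nw * ND| = logn p `|p%:Z ^+ (mu * phi) * NX ^+ lam * NG| by rewrite key.
have [Nw1 NG1] := (nz _ Nw0, nz _ NG0).
rewrite !abszM !lognM ?(muln_gt0, absz_gt0) ?expf_neq0 ?Nw1 ?NG1 //.
rewrite (aN _ Nw0) (aN _ NG0) addn0 add0n => ->.
by rewrite !abszX aNX !lognX (logn_prime _ pp) eqxx !muln1.
Qed.

(** * The Eisenstein factor of [(1+T)^(p^(m+1)) - 1] *)

Section CyclotomicFactor.
Variables (p m : nat).
Hypothesis p_prime : prime p.

Definition omega (j : nat) : {poly int} := (1 + 'X) ^+ (p ^ j) - 1.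
(** For prime [p] this is the cyclotomic polynomial of order [p ^ m.+1] evaluated at [1 + 'X]. *)
Definition cyclo : {poly int} := \sum_(i < p) ((1 + 'X) ^+ (p ^ m)) ^+ i.

Lemma omegaS : omega m.+1 = omega m * cyclo.
Proof. by rewrite /omega /cyclo expnSr exprM subrX1. Qed.

Lemma size_exp_1X j : size ((1 + 'X) ^+ j : {poly int}) = j.+1.
Proof.
have s2 : size (1 + 'X : {poly int}) = 2 by rewrite addrC size_XaddC.
have := size_exp (1 + 'X : {poly int}) j; rewrite s2 mul1n.
have : (0 < size ((1 + 'X) ^+ j : {poly int}))%N.
  by rewrite size_poly_gt0 expf_neq0 // -size_poly_eq0 s2.
by case: size => //= k _ ->.
Qed.

Lemma size_omega j : size (omega j) = (p ^ j).+1.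
Proof.
rewrite /omega size_polyDl size_exp_1X // size_polyN size_poly1 ltnS.
by rewrite expn_gt0 prime_gt0.
Qed.

Lemma monic_omega j : omega j \is monic.
Proof.
rewrite monicE /omega lead_coefDl; last first.
  by rewrite size_exp_1X size_polyN size_poly1 ltnS expn_gt0 prime_gt0.
by rewrite -monicE; apply: monic_exp; rewrite addrC -(opprK 1) -polyCN monicXsubC.
Qed.

Lemma monic_cyclo : cyclo \is monic.
Proof. by have := monic_omega m.+1; rewrite omegaS monicMl // monic_omega. Qed.

Lemma size_cyclo : (size cyclo).-1 = (p ^ m.+1 - p ^ m)%N.
Proof.
have := size_omega m.+1; rewrite omegaS size_Mmonic ?monic_cyclo ?monic_neq0 ?monic_omega //.
rewrite size_omega; have := monic_cyclo; move/monic_neq0; rewrite -size_poly_gt0.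
lia.
Qed.

(** Modulo [p], Frobenius turns [omega p j] into ['X^(p ^ j)], and cancelling in [omegaS] leaves a
    power of ['X]. The constant term of [cyclo] is a sum of [p] ones, whence [w.[0] = 1]. *)
Lemma cyclo_eisenstein : exists2 w : {poly int},
  cyclo = 'X^((size cyclo).-1) + p%:Z%:P * w & w.[0] = 1.
Proof.
have pF := pchar_Fp p_prime.
have red j : map_poly (intr : int -> 'F_p) (omega j) = 'X^(p ^ j).
  rewrite /omega rmorphB rmorphXn rmorphD /= !rmorph1 map_polyX exprDn_pchar.
    by rewrite expr1n addrAC subrr add0r.
  have pFX : p \in [pchar {poly 'F_p}] by rewrite pchar_lalg.
  by rewrite (eq_pnat _ (pcharf_eq pFX)) pnatX pnat_id.
have le : (p ^ m <= p ^ m.+1)%N by rewrite leq_exp2l // prime_gt1.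
have redc : map_poly (intr : int -> 'F_p) cyclo = 'X^((size cyclo).-1).
  have : 'X^(p ^ m) * map_poly (intr : int -> 'F_p) cyclo = 'X^(p ^ m) * 'X^((size cyclo).-1).
    by rewrite -red -rmorphM -omegaS !red -exprD size_cyclo subnKC //; apply: red.
  by move/mulfI; apply; rewrite -size_poly_eq0 size_polyXn.
have [i|w wE] := @poly_divisible p%:Z (cyclo - 'X^((size cyclo).-1)).
  rewrite (dvdz_pcharf pF) -[X in X == _]/((intr : int -> 'F_p) _) -coef_map rmorphB /=.
  by rewrite map_polyXn redc subrr coef0.
have cE : cyclo = 'X^((size cyclo).-1) + p%:Z%:P * w by rewrite -wE addrC subrK.
exists w => //.
have c0 : cyclo.[0] = p%:Z.
  rewrite /cyclo horner_sum -[RHS]natz -[p in RHS]card_ord -sum1_card natr_sum.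
  by apply: eq_bigr => i _; rewrite !horner_exp hornerD hornerX hornerC addr0 !expr1n.
have lt : (p ^ m < p ^ m.+1)%N by rewrite ltn_exp2l // prime_gt1.
have p0 : p%:Z != 0 by rewrite eqz_nat -lt0n prime_gt0.
move: c0; rewrite cE hornerD hornerM hornerC hornerXn expr0n size_cyclo subn_eq0 leqNgt lt.
by rewrite add0r -[RHS]mulr1 => /(mulfI p0).
Qed.

End CyclotomicFactor.

(** * Comparison with the Weierstrass factorisation *)

Lemma zres_mod p (a : zp p) j K : (j <= K)%N -> zres a j = (zres a K %% p ^ j)%N.
Proof.
move=> /subnK <-; elim: (K - j)%N => [|d IH]; first by rewrite add0n zres_coh modn_mod.
rewrite addSn IH [zres a (d + j)]zres_coh modn_dvdm //.
by rewrite dvdn_exp2l // leq_addl.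
Qed.

Lemma eq_Zp0 M (x : int) : (1 < M)%N -> (x%:~R == 0 :> 'Z_M) = (M%:Z %| x)%Z.
Proof.
move=> M1; have nat0 (k : nat) : (k%:R == 0 :> 'Z_M) = (M %| k)%N.
  by rewrite -val_eqE /= val_Zp_nat.
by rewrite dvdzE; case: x => k; rewrite ?NegzE ?rmorphN ?oppr_eq0 ?abszN -?pmulrn nat0.
Qed.

Section Congruence.
Variables (R : comNzRingType) (c : R).

Definition congr_mod (x y : R) := exists r, x = y + r * c.

Lemma congr_mod_refl x : congr_mod x x.
Proof. by exists 0; rewrite mul0r addr0. Qed.

Lemma congr_modD x y x' y' : congr_mod x y -> congr_mod x' y' -> congr_mod (x + x') (y + y').
Proof. by case=> r -> [r' ->]; exists (r + r'); ring. Qed.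

Lemma congr_modB x y x' y' : congr_mod x y -> congr_mod x' y' -> congr_mod (x - x') (y - y').
Proof. by case=> r -> [r' ->]; exists (r - r'); ring. Qed.

Lemma congr_modM x y x' y' : congr_mod x y -> congr_mod x' y' -> congr_mod (x * x') (y * y').
Proof. by case=> r -> [r' ->]; exists (r * y' + y * r' + r * c * r'); ring. Qed.

Lemma congr_mod_det n (A B : 'M[R]_n) :
  (forall i j, congr_mod (A i j) (B i j)) -> congr_mod (\det A) (\det B).
Proof.
move=> AB; rewrite /determinant.
elim/big_ind2: _ => [|? ? ? ?|s _]; [exact: congr_mod_refl|exact: congr_modD|].
apply: congr_modM; first exact: congr_mod_refl.
by elim/big_ind2: _ => [|? ? ? ?|i _]; [exact: congr_mod_refl|exact: congr_modM|].
Qed.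

End Congruence.

(** Truncation is not multiplicative, whereas congruence modulo ['X^m] passes through products and
    determinants. *)
Lemma trp_congr (R : comNzRingType) m (P Q : {poly R}) :
  congr_mod 'X^m P Q <-> trp m P = trp m Q.
Proof.
split=> [[r ->]|eqt]; first by rewrite /trp -/(take_poly m _) take_polyD take_polyMXn_0 addr0.
exists (drop_poly m P - drop_poly m Q); rewrite mulrBl.
have eqt' : take_poly m P = take_poly m Q by exact: eqt.
by rewrite -{1}(poly_take_drop m P) -{1}(poly_take_drop m Q) eqt'; ring.
Qed.

Lemma map_voltage_mx (V E : finType) (src dst : E -> V) Rm a (R S : nzRingType)
    (f : {rmorphism R -> S}) z :
  map_mx f (voltage_mx src dst Rm a z) = voltage_mx src dst Rm a (f z).
Proof.
apply/matrixP => i j; rewrite !mxE; case: ifP => _; first by rewrite rmorph_nat.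
by rewrite rmorph_sum; apply: eq_bigr => e _; rewrite rmorphB rmorphM !rmorph_nat rmorphXn.
Qed.

(** * Integer polynomials attached to the layers *)

Section Tower.
Variables (p : nat) (V E : finType) (src dst : E -> V) (Rm : {set V}) (alpha : E -> zp p).
Hypothesis p_prime : prime p.

Local Notation volt j := (fun e => zres (alpha e) j).

(** An integral substitute for [det M_alpha], with exponents reduced modulo [p ^ j]; it is the [D_j]
    of the overview. *)
Definition tower_poly (j : nat) : {poly int} :=
  \det (voltage_mx src dst Rm (volt j) (1 + 'X : {poly int})).

Lemma ev_tower_poly j z :
  ev (tower_poly j) z = \det (voltage_mx src dst Rm (volt j) (1 + z)).
Proof.
rewrite -horner_evalE -!det_map_mx !map_voltage_mx; congr (\det (voltage_mx _ _ _ _ _)).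
by rewrite rmorphD rmorph1 /= map_polyX horner_evalE hornerD hornerX hornerC.
Qed.

(** The exponents at levels [j] and [K] agree modulo [p ^ j]. Hence a polynomial of high level,
    close to the power series, can be evaluated in place of that of level [j]. *)
Lemma ev_tower_poly_eq j K z : (j <= K)%N -> (1 + z) ^+ (p ^ j) = 1 ->
  ev (tower_poly K) z = ev (tower_poly j) z.
Proof.
move=> jK z1; rewrite !ev_tower_poly; congr (\det _); apply/matrixP => i i'; rewrite !mxE.
case: ifP => // _; apply: eq_bigr => e _; congr (_ - _ * _).
by rewrite (zres_mod _ jK) expr_mod.
Qed.

Lemma omega_roots j (z : algC) : (p ^ j).-primitive_root z ->
  map_poly intr (omega p j) = \prod_(0 <= k < p ^ j) ('X - (z ^+ k - 1)%:P).
Proof.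
move=> pz; rewrite /omega rmorphB rmorphXn rmorphD /= !rmorph1 map_polyX.
have /(congr1 (comp_poly (1 + 'X))) := factor_Xn_sub_1 pz.
rewrite rmorphB rmorphXn /= comp_polyX rmorph1 rmorph_prod => <-.
apply: eq_bigr => k _; rewrite rmorphB /= comp_polyX comp_polyC polyCB.
by rewrite opprB addrA polyC1 [1 + _]addrC.
Qed.

Lemma root_omega j z : root (map_poly intr (omega p j)) z = ((1 + z) ^+ (p ^ j) == 1 :> algC).
Proof.
rewrite /root /omega rmorphB rmorphXn rmorphD /= !rmorph1 map_polyX.
by rewrite !hornerE subr_eq0.
Qed.

Lemma layer_det_norm j rs :
  map_poly intr (omega p j) = \prod_(z <- rs) ('X - z%:P) ->
  (\det (rooted_laplacian (cover_src src (N:=p ^ j)) (cover_dst dst (volt j) (N:=p ^ j))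
    (cover_ram Rm (p ^ j)) int))%:~R = \prod_(z <- rs) ev (tower_poly j) z.
Proof.
move=> ers; have N0 : (0 < p ^ j)%N by rewrite expn_gt0 prime_gt0.
have [z pz] := C_prim_root_exists N0.
have -> : \prod_(z <- rs) ev (tower_poly j) z =
    \prod_(0 <= k < p ^ j) ev (tower_poly j) (z ^+ k - 1).
  rewrite -(big_map (fun k => z ^+ k - 1) xpredT (fun y => ev (tower_poly j) y)).
  (* Two lists of roots of the same polynomial agree up to order. *)
  by apply/perm_big/prod_XsubC_eq; rewrite -ers (omega_roots pz) big_map.
rewrite big_mkord; under eq_bigr do rewrite ev_tower_poly addrC subrK.
rewrite -(det_cover_laplacian _ _ _ _ pz) -det_map_mx; congr (\det _).
apply/matrixP => x y; rewrite !mxE; case: ifP => _; first by rewrite rmorph_nat.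
by rewrite rmorph_sum; apply: eq_bigr => e _; rewrite rmorphB !rmorph_nat.
Qed.

Definition lift_trunc (F : ps p) k m : {poly int} := \poly_(j < m) (zres (F j) k.+1)%:Z.

Lemma map_lift_trunc (F : ps p) k m :
  map_poly (intr : int -> 'Z_(p ^ k.+1)) (lift_trunc F k m) = trunc F k m.
Proof.
apply/polyP => i; rewrite coef_map !coef_poly; by case: ifP.
Qed.

(** Level [k.+1 + m] is the one whose residues serve as exponents in [gpow], so the matrices agree
    entrywise modulo ['X^m] after transposition. *)
Lemma tower_poly_Mtr k m :
  trp m (map_poly (intr : int -> 'Z_(p ^ k.+1)) (tower_poly (k.+1 + m)))
  = trp m (\det (Mtr src dst Rm alpha k m)).
Proof.
apply/trp_congr; rewrite -det_map_mx map_voltage_mx -det_tr.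
apply: congr_mod_det => i j; rewrite !mxE.
rewrite rmorphD rmorph1 /= map_polyX.
case: ifPn => jR.
  rewrite subr0 eq_sym; case: eqP => [->|_]; last exact: congr_mod_refl.
  by rewrite jR; apply: congr_mod_refl.
rewrite sumrB; apply: congr_modB.
  rewrite eq_sym; case: eqP => [->|_]; last by rewrite big1 //; apply: congr_mod_refl.
  by rewrite (negPf jR) sumr_const /vdeg cardsE; apply: congr_mod_refl.
rewrite big_mkcondr; elim/big_ind2: _ => [|? ? ? ?|e _].
- exact: congr_mod_refl.
- exact: congr_modD.
case: ifP => _; rewrite ?mul1r ?mul0r; last exact: congr_mod_refl.
by apply/trp_congr; rewrite /gpow [RHS]take_poly_id // size_poly.
Qed.

(** Lifting the truncated factorisation to the integers leaves two errors: a multiple of [p ^ k.+1]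
    in degrees below [m], and a multiple of ['X^m]. *)
Lemma tower_poly_weierstrass k m mu (U f : ps p) :
  det_weierstrass src dst Rm alpha mu U f ->
  exists A B, tower_poly (k.+1 + m) =
    (p ^ mu)%:Z%:P * (lift_trunc U k m * lift_trunc f k m) + (p ^ k.+1)%:Z%:P * A + 'X^m * B.
Proof.
move/(_ k m) => dw; set Q := (_ * (_ * _)); set P := tower_poly _.
have M1 : (1 < p ^ k.+1)%N by rewrite -(exp1n k.+1) ltn_exp2r // prime_gt1.
have eqt : trp m (map_poly (intr : int -> 'Z_(p ^ k.+1)) P) =
           trp m (map_poly (intr : int -> 'Z_(p ^ k.+1)) Q).
  rewrite tower_poly_Mtr dw /Q !rmorphM /= !map_lift_trunc map_polyC /=.
  by rewrite -pmulrn polyC_natr.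
have [i|A AE] := @poly_divisible (p ^ k.+1)%:Z (take_poly m (P - Q)).
  rewrite coef_take_poly; case: ifP => [im|]; last by rewrite dvdz0.
  rewrite -eq_Zp0 // coefB rmorphB /= subr_eq0.
  have /polyP/(_ i) := eqt : take_poly m _ = take_poly m _.
  by rewrite !coef_take_poly im !coef_map => /eqP.
exists A, (drop_poly m (P - Q)).
by rewrite -addrA -AE [_ * drop_poly _ _]mulrC poly_take_drop addrC subrK.
Qed.

End Tower.

Section Weierstrass.
Variables (p : nat) (k m : nat).
Hypothesis p_prime : prime p.

(** Only the constant term modulo [p] matters, so the unit condition is read at its coarsest
    truncation. *)
Lemma lift_trunc_unit (U : ps p) : ps_unit U -> (0 < m)%N ->
  ~~ (p%:Z %| (lift_trunc U k m).[0])%Z.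
Proof.
case=> W /(_ 0%N 0%N) UW m0; rewrite horner_coef0 coef_poly m0 dvdzE /=.
apply/negP => dU.
have U0 : zres (U 0%N) 1 = 0%N by rewrite (zres_mod _ (ltn0Sn k)) expn1; apply/eqP.
move/polyP/(_ 0%N): UW; rewrite coef_poly /= coef0M /trunc coef_poly /= U0 mul0r coef1 /=.
by move/eqP; rewrite eq_sym oner_eq0.
Qed.

Lemma lift_trunc_distinguished (f : ps p) lam : distinguished f lam -> (lam < m)%N ->
  exists c, lift_trunc f k m = 'X^lam + p%:Z%:P * c.
Proof.
case=> f1 f0 fp lm.
have [i|c cE] := @poly_divisible p%:Z (lift_trunc f k m - 'X^lam); last first.
  by exists c; rewrite -cE addrC subrK.
rewrite coefB coefXn coef_poly.
have M1 : (1 < p ^ k.+1)%N by rewrite -(exp1n k.+1) ltn_exp2r // prime_gt1.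
case: (ltngtP i lam) => [il|li|->]; last by rewrite lm f1 modn_small // subrr dvdz0.
  rewrite (ltn_trans il lm) subr0 dvdzE /=.
  by have := fp _ il; rewrite (zres_mod _ (ltn0Sn k)) expn1 => /eqP.
by rewrite (f0 _ li) if_same subr0 dvdz0.
Qed.
End Weierstrass.

(** * From one layer to the next *)

Section TowerStep.
Variables (p : nat) (V E : finType) (src dst : E -> V) (Rm : {set V}) (alpha : E -> zp p).
Hypothesis p_prime : prime p.

(** The roots of [omega p j.+1] are those of [omega p j], which reproduce [L j], together with those
    of [cyclo p j], over which [N] is the norm. *)
Lemma tower_step mu lam (U f : ps p) j
    (L := fun i => \det (rooted_laplacian (cover_src src (N:=p ^ i))
      (cover_dst dst (fun e => zres (alpha e) i) (N:=p ^ i)) (cover_ram Rm (p ^ i)) int)) :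
  ps_unit U -> distinguished f lam -> det_weierstrass src dst Rm alpha mu U f ->
  (lam < p ^ j.+1 - p ^ j)%N ->
  exists N : int, [/\ L j.+1 = L j * N, N != 0
    & logn p `|N| = (mu * (p ^ j.+1 - p ^ j) + lam)%N].
Proof.
have szP := size_cyclo j p_prime; rewrite -szP.
pose phi := (size (cyclo p j)).-1; move=> uU df dw lamphi.
have [w PE w0] := cyclo_eisenstein j p_prime.
have mP := monic_cyclo j p_prime.
have [rs] := closed_field_poly_normal (map_poly (intr : int -> algC) (cyclo p j)).
have -> : lead_coef (map_poly (intr : int -> algC) (cyclo p j)) = 1.
  by rewrite lead_coef_map_inj ?(monicP mP) //; apply: intr_inj.
rewrite scale1r => Prs.
have N0 : (0 < p ^ j)%N by rewrite expn_gt0 prime_gt0.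
have [z pz] := C_prim_root_exists N0.
pose rs0 := [seq z ^+ k - 1 | k <- index_iota 0 (p ^ j)].
have ers0 : map_poly intr (omega p j) = \prod_(y <- rs0) ('X - y%:P).
  by rewrite (omega_roots pz) big_map.
have ers : map_poly intr (omega p j.+1) = \prod_(y <- rs0 ++ rs) ('X - y%:P).
  by rewrite omegaS rmorphM /= ers0 Prs big_cat.
(* With [k = mu.+1], this is the precision that [eisenstein_norm] asks for. *)
pose m := (mu.+2 * phi)%N.
have lm : (lam < m)%N by apply: (leq_trans lamphi); rewrite /m leq_pmull.
have [c fE] := lift_trunc_distinguished mu.+1 p_prime df lm.
have U0 := lift_trunc_unit mu.+1 uU (leq_ltn_trans (leq0n _) lm).
have [A [B DE]] := tower_poly_weierstrass p_prime mu.+1 m dw.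
rewrite fE in DE.
(* The approximating polynomial has level [mu.+2 + m]; it takes the right values at the roots of
   [omega p j.+1] once this level is at least [j.+1]. *)
have jK : (j.+1 <= mu.+2 + m)%N.
  have jp : (j < p ^ j)%N by rewrite ltn_expl // prime_gt1.
  have le : (p ^ j <= phi)%N.
    by rewrite /phi szP expnS; have := prime_gt1 p_prime; nia.
  by apply: leq_trans jp _; apply: leq_trans le _; rewrite /m; nia.
have [N [NE Nn0 Nlog]] := eisenstein_norm p_prime mP lamphi PE w0 Prs U0 DE.
exists N; split=> //.
apply: (@intr_inj algC); rewrite rmorphM /= /L.
rewrite (layer_det_norm _ _ _ _ p_prime ers) (layer_det_norm _ _ _ _ p_prime ers0) NE.
rewrite big_cat /=; congr (_ * _); apply: eq_big_seq => y yrs.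
  apply: ev_tower_poly_eq => //; apply/eqP.
  by rewrite -root_omega ers0 root_prod_XsubC.
symmetry; apply: ev_tower_poly_eq => //; apply/eqP.
by rewrite -root_omega ers root_prod_XsubC mem_cat yrs orbT.
Qed.

End TowerStep.

Theorem theorem6p8 (p : nat) (V E : finType) (src dst : E -> V) (bar : E -> E)
    (Rm : {set V}) (alpha : E -> zp p) (mu lam : nat) (U f : ps p) :
  prime p ->
  is_graph src dst bar ->
  gconnected src dst ->
  (#|Rm| = 1%N \/ #|Rm| = 2%N) ->
  every_admissible_path_shares_edge src dst bar Rm ->
  voltage bar alpha ->
  (forall n : nat, gconnected (@layer_src p V E src Rm n) (@layer_dst p V E dst Rm alpha n)) ->
  ps_unit U ->
  distinguished f lam ->
  det_weierstrass src dst Rm alpha mu U f ->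
  exists nu : int, exists N : nat, forall n : nat, (N <= n)%N ->
    ((logn p (layer_F src dst bar Rm alpha n #|Rm|))%:Z
     = (mu * p ^ n + lam * n)%:Z + nu)%R.
Proof.
move=> pp gG _ cR _ vG conn uU df dw.
have R0 : (0 < #|Rm|)%N by case: cR => ->.
have p0 := prime_gt0 pp.
pose F n := layer_F src dst bar Rm alpha n #|Rm|.
have F0 n : (0 < F n)%N by apply: layer_F_gt0.
(* The bound [lam <= n] is enough because [n < p ^ n <= p ^ n.+1 - p ^ n]. *)
have step n : (lam <= n)%N ->
    logn p (F n.+1) = (logn p (F n) + (mu * (p ^ n.+1 - p ^ n) + lam))%N.
  move=> ln; have lphi : (lam < p ^ n.+1 - p ^ n)%N.
    have jp : (n < p ^ n)%N by rewrite ltn_expl // prime_gt1.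
    by rewrite expnS; have := prime_gt1 pp; nia.
  have [N []] := tower_step pp uU df dw lphi.
  rewrite !(layer_F_det Rm _ p0 gG vG) -/(F n) -/(F n.+1) !natz => /(congr1 absz).
  rewrite abszM /= => -> Nn0 <-; by rewrite lognM ?absz_gt0.
(* This [nu] makes the formula exact at [n = lam], where the induction starts; the increments then
   telescope. *)
exists ((logn p (F lam))%:Z - (mu * p ^ lam + lam * lam)%:Z), lam => n /subnK <-.
elim: (n - lam)%N => [|d IH]; first by rewrite add0n addrC subrK.
rewrite addSn step ?leq_addl // PoszD IH.
have le : (p ^ (d + lam) <= p ^ (d + lam).+1)%N by rewrite leq_exp2l // prime_gt1.
have -> : (mu * p ^ (d + lam).+1 + lam * (d + lam).+1 =
  (mu * p ^ (d + lam) + lam * (d + lam)) + (mu * (p ^ (d + lam).+1 - p ^ (d + lam)) + lam))%N.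
  by rewrite mulnBr mulnS; have := leq_mul (leqnn mu) le; lia.
by rewrite [in RHS]PoszD addrAC.
Qed.
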